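(* Let $(A,\mu)$ be a partially crossed topological $G-R$-bimodule, and let $G$ be a first countable group. Let $R$ be locally compact and let $A$ be a compact radical-based group with $H^{0}(G,A)=A$. Then $H^{1}(G,(A,\mu))$ is a $k$-space.
   Context: All topological groups ($G$, $R$, $A$) are assumed Hausdorff (not necessarily abelian). A topological $G$-module is a topological group $A$ with a continuous left action of the topological group $G$ on $A$ by group automorphisms, $(g,a)\mapsto {}^{g}a$. Every topological group acts on itself by conjugation: ${}^{g}h=ghg^{-1}$. If several groups act on $A$, a word acts by successive actions, e.g. ${}^{grg^{-1}}a={}^{g}({}^{r}({}^{g^{-1}}a))$. A precrossed topological $R$-module is a pair $(A,\mu)$ where $A$ is a topological $R$-module and $\mu:A\to R$ is a continuous homomorphism with $\mu({}^{r}a)={}^{r}\mu(a)=r\mu(a)r^{-1}$ for all $r\in R$, $a\in A$. It is a partially crossed topological $R$-module if ${}^{\mu(a)}b={}^{a}b=aba^{-1}$ for all $b\in A$ and all $a\in A$ with $\mu(a)\in[R,R]$ (the commutator subgroup). A precrossed topological $G-R$-bimodule is a precrossed topological $R$-module $(A,\mu)$ such that (1) $G$ acts continuously (by automorphisms) on $R$ and on $A$; (2) $\mu$ is a $G$-homomorphism, i.e. $\mu({}^{g}a)={}^{g}\mu(a)$; (3) ${}^{({}^{g}r)}a={}^{grg^{-1}}a$ for all $g\in G$, $r\in R$, $a\in A$. It is a partially crossed topological $G-R$-bimodule if moreover $(A,\mu)$ is a partially crossed topological $R$-module. A crossed homomorphism is a map $\alpha:G\to A$ with $\alpha(gh)=\alpha(g)\,{}^{g}\alpha(h)$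 for all $g,h\in G$. $Der_{c}(G,(A,\mu))$ is the set of pairs $(\alpha,r)$ with $\alpha:G\to A$ a continuous crossed homomorphism and $r\in R$ such that $\mu(\alpha(g))=r\,({}^{g}r)^{-1}$ for all $g\in G$. It carries the subspace topology from $\mathcal{C}_{k}(G,A)\times R$, where $\mathcal{C}_{k}(G,A)$ is the set of continuous maps $G\to A$ with the compact-open topology. For a topological $G$-module $B$, $H^{0}(G,B)=\{b\in B: {}^{g}b=b\ \forall g\in G\}$. On $Der_{c}(G,(A,\mu))$ define $(\alpha,r)\sim(\beta,s)$ iff there is $a\in A$ with $\beta(g)=a^{-1}\alpha(g)\,{}^{g}a$ for all $g\in G$ and $s=\mu(a)^{-1}r$ mod $H^{0}(G,R)$ (i.e. $s\in\mu(a)^{-1}rH^{0}(G,R)$). This is an equivalence relation, and $H^{1}(G,(A,\mu))$ is the quotient set $Der_{c}(G,(A,\mu))/\sim$ with the quotient topology. A topological group $A$ is radical-based if it has a countable base $\{U_{n}\}_{n\in\mathbb{N}}$ at $1$ such that each $U_{n}$ is symmetric and for all $n\in\mathbb{N}$: (1) $(U_{n})^{n}\subset U_{1}$; (2) $a,a^{2},\dots,a^{n}\in U_{1}$ implies $a\in U_{n}$. A topological space $X$ is a $k$-space if every subset of $X$ whose intersection with every compact $K\subset X$ is relatively open in $K$ is open in $X$. *)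

(* Defs.v *)
From HB Require Import structures.
From mathcomp Require Import all_boot.
From mathcomp Require Import all_classical topology.

Set Implicit Arguments.
Unset Strict Implicit.
Unset Printing Implicit Defensive.

Local Open Scope classical_set_scope.
Local Open Scope quotient_scope.
Local Open Scope group_scope.

HB.mixin Record isTopologicalGroup G of Topological G & Group G := {
  mulg_continuous : continuous (fun x : G * G => x.1 * x.2);
  invg_continuous : continuous (fun x : G => x^-1)
}.

#[short(type="topologicalGroupType")]
HB.structure Definition TopologicalGroup :=
  {G of Topological G & Group G & isTopologicalGroup G}.

(* The subgroup generated by the commutators, without topological closure;
   MathComp's [derived] subgroup is restricted to finite groups. *)
Definition commutator_subgroup (R : groupType) : set R :=
  smallest (fun H : set R => group_closed (mem H))
           [set z | exists x y : R, z = [~ x, y]].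

(* The sets of the base are indexed by n >= 1, and are neighbourhoods of 1 that
   need not be open. *)
Definition radical_based (A : topologicalGroupType) : Prop :=
  exists U : nat -> set A,
    [/\ forall n, (0 < n)%N -> nbhs 1 (U n),
        forall V, nbhs 1 V -> exists2 n, (0 < n)%N & U n `<=` V,
        forall n, (0 < n)%N -> forall a, U n a -> U n a^-1,
        forall n, (0 < n)%N -> forall a : 'I_n -> A,
          (forall i, U n (a i)) -> U 1%N (\prod_(i < n) a i) &
        forall n, (0 < n)%N -> forall a : A,
          (forall k, (1 <= k <= n)%N -> U 1%N (a ^+ k)) -> U n a].

Definition first_countable (X : topologicalType) : Prop :=
  forall x : X, exists2 B : set (set X), countable B &
    (B `<=` nbhs x) /\ (forall V, nbhs x V -> exists2 W, B W & W `<=` V).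

Definition k_space (X : topologicalType) : Prop :=
  forall S : set X,
    (forall K : set X, compact K -> open (S : set (subspace K))) -> open S.

(* The library's compact-open topology lives on all functions [X -> Y]. *)
Definition continuous_maps (X Y : topologicalType) : Type := continuousType X Y.

HB.instance Definition _ (X Y : topologicalType) :=
  Topological.copy (continuous_maps X Y)
    (initial_topology (fun f : continuousType X Y =>
                         (f : X -> Y) : {compact-open, X -> Y})).

Definition fun_of_continuous_maps (X Y : topologicalType)
  (f : continuous_maps X Y) : X -> Y := (f : continuousType X Y).
Coercion fun_of_continuous_maps : continuous_maps >-> Funclass.

Record topModule (G A : topologicalGroupType) := TopModule {
  act :> G -> A -> A;
  act_mul : forall g a b, act g (a * b) = act g a * act g b;
  act_one : forall a, act 1 a = a;
  act_comp : forall g h a, act (g * h) a = act g (act h a);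
  act_continuous : continuous (fun x : G * A => act x.1 x.2)
}.

Definition H0 (G B : topologicalGroupType) (M : topModule G B) : set B :=
  [set b | forall g, M g b = b].

Record precrossedModule (R A : topologicalGroupType) := PrecrossedModule {
  actRA : topModule R A;
  mu : A -> R;
  mu_continuous : continuous mu;
  mu_mul : forall a b, mu (a * b) = mu a * mu b;
  mu_act : forall r a, mu (actRA r a) = r * mu a * r^-1
}.

Definition partially_crossed (R A : topologicalGroupType)
    (M : precrossedModule R A) : Prop :=
  forall a b : A, commutator_subgroup (mu M a) ->
    actRA M (mu M a) b = a * b * a^-1.

Record precrossedBimodule (G R A : topologicalGroupType) := PrecrossedBimodule {
  bimod_module :> precrossedModule R A;
  actGR : topModule G R;
  actGA : topModule G A;
  mu_actG : forall g a, mu bimod_module (actGA g a) = actGR g (mu bimod_module a);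
  bimod_compat : forall g r a,
    actRA bimod_module (actGR g r) a =
    actGA g (actRA bimod_module r (actGA g^-1 a))
}.

Section Cohomology.
Context (G R A : topologicalGroupType) (M : precrossedBimodule G R A).

Definition crossed_hom (alpha : G -> A) : Prop :=
  forall g h, alpha (g * h) = alpha g * actGA M g (alpha h).

Definition Der_set :=
  [set p : (continuous_maps G A * R)%type | crossed_hom p.1 /\
           forall g, mu M (p.1 g) = p.2 * (actGR M g p.2)^-1].

(* [set_type] carries the subspace topology. *)
Definition Der : topologicalType := set_type Der_set.

Definition Der_equiv (p q : Der) : Prop :=
  let: (alpha, r) := val p in
  let: (beta, s) := val q in
  exists a : A,
    (forall g, beta g = a^-1 * alpha g * actGA M g a) /\
    (exists2 h, H0 (actGR M) h & s = (mu M a)^-1 * r * h).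

Definition Der_rel (p q : Der) : bool := `[< Der_equiv p q >].

Lemma act1 (B C : topologicalGroupType) (N : topModule B C) b : N b 1 = 1.
Proof. by apply: (@mulgI _ (N b 1)); rewrite -act_mul !mulg1. Qed.

Lemma actV (B C : topologicalGroupType) (N : topModule B C) b c :
  N b c^-1 = (N b c)^-1.
Proof. by apply: (@mulgI _ (N b c)); rewrite -act_mul !mulgV act1. Qed.

Lemma mu1 : mu M 1 = 1.
Proof. by apply: (@mulgI _ (mu M 1)); rewrite -mu_mul !mulg1. Qed.

Lemma muV a : mu M a^-1 = (mu M a)^-1.
Proof. by apply: (@mulgI _ (mu M a)); rewrite -mu_mul !mulgV mu1. Qed.

Lemma Der_rel_refl : reflexive Der_rel.
Proof.
move=> p; apply/asboolP; rewrite /Der_equiv; case: (val p) => alpha r.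
exists 1; split=> [g|]; first by rewrite act1 invg1 mul1g mulg1.
by exists 1; [move=> g; exact: act1 | rewrite mu1 invg1 mul1g mulg1].
Qed.

Lemma Der_rel_sym : symmetric Der_rel.
Proof.
suff H p q : Der_rel p q -> Der_rel q p by move=> p q; apply/idP/idP; exact: H.
move=> /asboolP; rewrite /Der_rel /Der_equiv.
case: (val p) => alpha r; case: (val q) => beta s [a [e [h hh ->]]].
apply/asboolP; exists a^-1; split=> [g|].
  by rewrite e actV invgK !mulgA mulgV mul1g -mulgA mulgV mulg1.
exists h^-1; first by move=> g; rewrite actV hh.
by rewrite muV invgK !mulgA mulgV mul1g -mulgA mulgV mulg1.
Qed.

Lemma Der_rel_trans : transitive Der_rel.
Proof.
move=> q p t /asboolP + /asboolP; rewrite /Der_rel /Der_equiv.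
case: (val p) => alpha r; case: (val q) => beta s; case: (val t) => gam u.
move=> [a [ea [h hh ->]]] [b [eb [k hk ->]]].
apply/asboolP; exists (a * b); split=> [g|].
  by rewrite eb ea act_mul invgM !mulgA.
exists (h * k); first by move=> g; rewrite act_mul hh hk.
by rewrite mu_mul invgM !mulgA.
Qed.

Canonical Der_equiv_rel :=
  EquivRel Der_rel Der_rel_refl Der_rel_sym Der_rel_trans.

Definition H1 : topologicalType := quotient_topology {eq_quot Der_equiv_rel}.

End Cohomology.

(* Main.v *)
From HB Require Import structures.
Require Import Defs.
From mathcomp Require Import all_boot all_classical topology.

Set Implicit Arguments.
Unset Strict Implicit.
Unset Printing Implicit Defensive.

Local Open Scope classical_set_scope.
Local Open Scope quotient_scope.
Local Open Scope group_scope.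

(** Quotients of k-spaces are k-spaces, so it suffices to treat [Der M]. As [G]
    acts trivially on [A], a point of [Der M] is a pair [(alpha, r)] of a
    continuous homomorphism [alpha : G -> A] and some [r : R] satisfying a
    closed condition. The proof is the Banach-Dieudonne argument which shows
    that the dual of a metrizable group is a k-space, with the compact
    radical-based group [A] in the place of the circle.

    Let [U_n] be the base of [A] and let [E] be a closed neighbourhood of [1]
    inside [U_1]. If a homomorphism maps a neighbourhood [V] of [1] into [E],
    then it maps every [x] with [x, ..., x ^+ n] in [V] into [U_n]; hence the
    homomorphisms that map [V] into [E] are equicontinuous
    ([radical_based_equicontinuous]). By Ascoli's theorem and the compactness
    of [A], the pairs [(alpha, r)] with [alpha] mapping [V] into [E] and [r] in
    a compact set form a compact set ([Der_compact]).

    Now let [O] be a subset of [Der M] that is open relative to every compact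
    set, and let [p = (alpha, r)] be in [O]. Take a decreasing base [V n] of
    neighbourhoods of [1] in [G], all mapped by [alpha] close to [1], and let
    [K n] be the set of the [q = (beta, s)] with [beta] mapping [V n] into [E].
    Some closed neighbourhood [T 0] of [p], with second components in a compact
    set, meets [K 0] inside [O]. Given a closed subset [T n] of [T 0] that meets
    [K n] inside [O], compactness yields a finite subset [F n] of [V n] such
    that the points of [T n] that are close to [p] on [F n], up to an error that
    does not depend on [n], form a closed set [T n.+1] that meets [K n.+1] inside
    [O]
    ([finite_separation]). The union of the [F n] and of [{1}] is compact, as
    the [F n] shrink to [1]. So being in [T 0] and close to [p] on this union is
    a neighbourhood of [p]; it lies in every [T n], and every point is in some
    [K n], whence it lies in [O]. *)

(** * k-spaces and countable bases *)

Lemma k_spaceP (X : topologicalType) :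
  (forall S : set X,
    (forall K x, compact K -> K x -> S x -> \forall y \near x, K y -> S y) ->
    forall x, S x -> nbhs x S) ->
  k_space X.
Proof.
move=> kX S kS; rewrite openE => x Sx; apply: kX Sx => K {}x cK Kx Sx.
have /open_subspaceP[V oV VS] := kS K cK.
have Vx : V x by have [] : (V `&` K) x by rewrite VS.
have : nbhs x V by move: oV; rewrite openE; apply.
by apply: filterS => y Vy Ky; have [] : (S `&` K) y by rewrite -VS.
Qed.

Lemma k_space_quotient (X : topologicalType) (Q : quotType X) :
  k_space X -> k_space (quotient_topology Q).
Proof.
move=> kX S kS; apply: kX => K cK.
pose q : X -> quotient_topology Q := \pi.
have cqK : compact (q @` K).
  apply: continuous_compact cK.
  by apply: continuous_subspaceT; exact: pi_continuous.
have /open_subspaceP[V oV VS] := kS _ cqK.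
apply/open_subspaceP; exists (q @^-1` V) => //.
apply/seteqP; split=> x [Hx Kx]; split=> //.
  by have [] : (S `&` q @` K) (q x) by rewrite -VS; split=> //; exists x.
by have [] : (V `&` q @` K) (q x) by rewrite VS; split=> //; exists x.
Qed.

(** If [f] numbers a countable base, intersect its members of number below [n];
    since [f] is injective, each step adds at most one member. *)
Lemma first_countable_base (X : topologicalType) (x : X) : first_countable X ->
  exists V : nat -> set X, [/\ forall n, nbhs x (V n),
    forall m n, (m <= n)%N -> V n `<=` V m &
    forall N, nbhs x N -> exists n, V n `<=` N].
Proof.
move=> /(_ x)[B /countable_injP[f fi] [Bx xB]].
exists (fun n y => forall W, B W -> (f W < n)%N -> W y); split.
- elim=> [|n IHn]; first by apply: filterE => y W.
  have : nbhs x (fun y => forall W, B W -> f W = n -> W y).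
    have [[W [BW fW]]|nW] := pselect (exists W, B W /\ f W = n).
      have := Bx _ BW; apply: filterS => y Wy W' BW' fW'.
      by rewrite (_ : W' = W) //; apply: fi; rewrite ?inE ?fW'.
    by apply: filterE => y W BW fW; case: nW; exists W.
  apply: filterS2 IHn => y Vy Wy W BW; rewrite ltnS leq_eqVlt.
  by move=> /orP[/eqP|]; [exact: Wy|exact: Vy].
- by move=> m n mn y Vy W BW fW; apply: Vy => //; exact: leq_trans mn.
- move=> N /xB[W BW WN]; exists (f W).+1 => y Vy.
  by apply: WN; exact: Vy.
Qed.

(** All but finitely many points of the union lie in any given neighbourhood of
    [x]. *)
Lemma compact_finite_sets_tending (X : topologicalType) (x : X)
    (V : nat -> set X) (F : nat -> seq X) :
  (forall m n, (m <= n)%N -> V n `<=` V m) ->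
  (forall N, nbhs x N -> exists n, V n `<=` N) ->
  (forall n y, y \in F n -> V n y) ->
  compact [set y | y = x \/ exists n, y \in F n].
Proof.
move=> Vdecr Vbase FV; apply/compact_near_coveringP => I i P FI cov.
have [[U1 U2] /= [xU1 iU2] UP] := cov x (or_introl erefl).
have [n VU1] := Vbase _ xU1.
have Fin (s : seq X) : {subset s <= [pred y | `[< exists m, y \in F m >] ]} ->
    \forall j \near i, forall y, y \in s -> P j y.
  elim: s => [|y s IHs] sF; first by apply: filterE.
  have [] := cov y; first by right; have /asboolP := sF y (mem_head _ _).
  move=> [W1 W2] /= [W1y iW2] WP.
  have : \forall j \near i, forall z, z \in s -> P j z.
    by apply: IHs => z zs; apply: sF; rewrite inE zs orbT.
  apply: filterS2 iW2 => j W2j Ps z.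
  rewrite inE => /predU1P[->|]; last exact: Ps.
  by apply: (WP (y, j)); split=> //; exact: nbhs_singleton.
have : \forall j \near i, forall m, (m < n)%N -> forall y, y \in F m -> P j y.
  elim: {VU1} n => [|n IHn]; first by apply: filterE.
  have := Fin (F n) _.
  have /[swap] /[apply] :
      {subset F n <= [pred y | `[< exists m, y \in F m >] ]}.
    by move=> y yF; apply/asboolP; exists n.
  apply: filterS2 IHn => j Pj Pn m; rewrite ltnS leq_eqVlt => /predU1P[->|/Pj//].
  exact: Pn.
apply: filterS2 iU2 => j U2j Pj y [->|[m yFm]].
  by apply: (UP (x, j)); split=> //; exact: nbhs_singleton.
have [/Pj|nm] := ltnP m n; first exact.
apply: (UP (y, j)); split=> //; apply: VU1; apply: Vdecr nm _ _; exact: FV.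
Qed.

(** * Neighbourhoods in topological groups *)

Section TopologicalGroups.
Context (H : topologicalGroupType).

Lemma cvgMg (T : Type) (F : set_system T) {FF : Filter F} (f g : T -> H)
    (a b : H) :
  f @ F --> a -> g @ F --> b -> (fun x => f x * g x) @ F --> a * b.
Proof.
move=> fa gb.
apply: (@cvg_comp _ _ _ (fun x => (f x, g x)) (fun x : H * H => x.1 * x.2)
  _ (nbhs (a, b))); first exact: cvg_pair.
exact: (@mulg_continuous H (a, b)).
Qed.

Lemma cvgVg (T : Type) (F : set_system T) {FF : Filter F} (f : T -> H)
    (a : H) :
  f @ F --> a -> (fun x => (f x)^-1) @ F --> a^-1.
Proof.
move=> fa.
apply: (@cvg_comp _ _ _ f (fun x => x^-1) _ (nbhs a)) => //.
exact: invg_continuous.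
Qed.

Lemma nbhs_mulg (x : H) (N : set H) :
  nbhs x N <-> nbhs 1 [set a | N (x * a)].
Proof.
split=> [xN|N1].
  have : (fun a => x * a) @ (1 : H) --> x * 1.
    by apply: (cvgMg (cvg_cst _) cvg_id).
  by rewrite mulg1; exact.
have : (fun a => x^-1 * a) @ x --> x^-1 * x.
  by apply: (cvgMg (cvg_cst _) cvg_id).
rewrite mulVg => /(_ _ N1) N2.
have : \forall a \near x, N (x * (x^-1 * a)) by [].
by apply: filterS => y /=; rewrite mulVKg.
Qed.

Lemma nbhs1_split (U : set H) : nbhs 1 U -> exists2 V, nbhs 1 V &
  forall a b, V a -> V b -> [/\ U (a * b), U (a^-1 * b) & U (a * b^-1)].
Proof.
move=> U1.
have c1 : (fun x : H * H => x.1) @ ((1, 1) : H * H) --> (1 : H).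
  exact: cvg_fst.
have c2 : (fun x : H * H => x.2) @ ((1, 1) : H * H) --> (1 : H).
  exact: cvg_snd.
have h1 : \forall x \near ((1, 1) : H * H), U (x.1 * x.2).
  by apply: (cvgMg c1 c2); rewrite mulg1.
have h2 : \forall x \near ((1, 1) : H * H), U (x.1^-1 * x.2).
  by apply: (cvgMg (cvgVg c1) c2); rewrite invg1 mulg1.
have h3 : \forall x \near ((1, 1) : H * H), U (x.1 * x.2^-1).
  by apply: (cvgMg c1 (cvgVg c2)); rewrite invg1 mulg1.
have [[V V'] /= [V1 V'1] VV'] := filterI h1 (filterI h2 h3).
exists (V `&` V'); first exact: filterI.
by move=> a b [Va V'a] [Vb V'b]; have [//|? []] := VV' (a, b).
Qed.

Lemma nbhs1_closed (U : set H) : nbhs 1 U ->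
  exists2 W, closed W & nbhs 1 W /\ W `<=` U.
Proof.
move=> /nbhs1_split[V V1 VU]; exists (closure V); first exact: closed_closure.
split; first by apply: filterS V1; exact: subset_closure.
move=> x clVx; have [|y [Vy Vxy]] := clVx [set y | V (x^-1 * y)].
  by apply/nbhs_mulg; apply: filterS V1 => a /=; rewrite mulKg.
have [_ _] := VU _ _ Vy Vxy.
by rewrite invgM invgK mulgA mulgV mul1g.
Qed.

Lemma nbhs_closed (x : H) (U : set H) : nbhs x U ->
  exists2 W, closed W & nbhs x W /\ W `<=` U.
Proof.
move=> /nbhs_mulg /nbhs1_closed[W clW [W1 WU]].
exists [set y | W (x^-1 * y)]; last split.
- apply: (@preimage_closed _ _ (fun y => x^-1 * y)) => //.
  by move=> y _; apply: cvgMg; [exact: cvg_cst|exact: cvg_id].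
- by apply/nbhs_mulg; apply: filterS W1 => a /=; rewrite mulKg.
- by move=> y /WU /=; rewrite mulVKg.
Qed.

End TopologicalGroups.

(** * The topology of Der *)

Lemma initial_cvgP (S : choiceType) (T : topologicalType) (f : S -> T)
    (F : set_system S) (s : S) : Filter F ->
  F --> (s : initial_topology f) <-> f @ F --> f s.
Proof.
move=> FF; split=> [Fs|Ffs].
  exact: (@cvg_comp _ _ _ (id : S -> initial_topology f) f _ _ _ Fs
    (@initial_continuous _ _ f s)).
move=> N [_ [[O oO <-] Ofs ON]]; rewrite nbhs_filterE.
apply: filterS ON _; apply: Ffs.
by move: oO; rewrite openE; exact.
Qed.

Section CompactConvergence.
Context (X : topologicalType) (B : topologicalGroupType).

(** Near a continuous map, the compact-open topology is the topology of uniform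
    convergence on compact sets, for the left uniformity of the group [B]. *)
Lemma compact_open_uniformP (D : Type) (F : set_system D) {FF : Filter F}
    (f : D -> X -> B) (alpha : X -> B) : continuous alpha ->
  (forall K O, compact K -> open O -> alpha @` K `<=` O ->
     \forall q \near F, f q @` K `<=` O) <->
  (forall K W, compact K -> nbhs 1 W ->
     \forall q \near F, forall x, K x -> W ((alpha x)^-1 * f q x)).
Proof.
move=> ca; split=> [Fo K W cK W1|Fu K O cK oO aKO].
  move/compact_near_coveringP/near_covering_withinP: (cK).
  apply => x Kx.
  (* Near [x], [alpha] takes values in the closed set [alpha x * Z]; on the
     compact part of [K] where it does, [f q] eventually takes values in the
     open set [alpha x * V°], which contains [alpha x * Z]. *)
  have [V V1 VW] := nbhs1_split W1.
  have [Z clZ [Z1 ZV]] := nbhs1_closed (nbhs_interior V1).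
  have ctr (b : B) : continuous (fun y => b * y).
    by move=> y; apply: (cvgMg (cvg_cst _) cvg_id).
  have cxa : continuous (fun y => (alpha x)^-1 * alpha y).
    by move=> y; apply: (cvgMg (cvg_cst _) (ca y)).
  pose K' := K `&` [set y | Z ((alpha x)^-1 * alpha y)].
  have cK' : compact K'.
    apply: compact_closedI cK _.
    by apply: (@preimage_closed _ _ (fun y => (alpha x)^-1 * alpha y)) => // y _;
      exact: cxa.
  have xZ : \forall y \near x, Z ((alpha x)^-1 * alpha y).
    by apply: cxa; rewrite mulVg.
  have : \forall q \near F, f q @` K' `<=` [set b | V° ((alpha x)^-1 * b)].
    apply: Fo => //.
      by apply: open_comp (open_interior V) => y _; exact: ctr.
    by move=> _ [y [_ Zy] <-]; exact: ZV.
  move=> FK'; exists ([set y | Z ((alpha x)^-1 * alpha y)],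
    [set q | f q @` K' `<=` [set b | V° ((alpha x)^-1 * b)]]) => //.
  move=> [y q] [/= Zy qK'] Ky.
  have V1y : V ((alpha x)^-1 * alpha y) by apply: interior_subset; exact: ZV.
  have V2y : V ((alpha x)^-1 * f q y).
    by apply: interior_subset; apply: qK'; exists y.
  have [_ + _] := VW _ _ V1y V2y.
  by rewrite invgM invgK -mulgA mulVKg.
have [W W1 KWO] : exists2 W, nbhs 1 W &
    forall x a, K x -> W a -> O (alpha x * a).
  exists [set a | K `<=` [set x | O (alpha x * a)]]; last by move=> x a Kx; apply.
  move/compact_near_coveringP: cK; apply => x Kx.
  have Oax : nbhs (alpha x) O.
    by move: oO; rewrite openE; apply; apply: aKO; exists x.
  have ax : (fun z : X * B => alpha z.1 * z.2) @ ((x, 1) : X * B) -->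
      alpha x * 1.
    apply: cvgMg; last exact: cvg_snd.
    apply: (@cvg_comp _ _ _ fst alpha _ (nbhs x)); last exact: ca.
    exact: cvg_fst.
  by move: ax; rewrite mulg1 => /(_ _ Oax).
apply: filterS (Fu K W cK W1) => q qW _ [x Kx <-].
by rewrite -(mulVKg (alpha x) (f q x)); apply: KWO => //; exact: qW.
Qed.

End CompactConvergence.

Section Cocycles.
Context (G R A : topologicalGroupType) (M : precrossedBimodule G R A).

Definition cocycle (p : Der M) : G -> A := (val p).1.
Definition twist (p : Der M) : R := (val p).2.

Lemma cocycle_continuous p : continuous (cocycle p).
Proof. exact: cts_fun. Qed.

Lemma Der_cvgP (F : set_system (Der M)) (p : Der M) : Filter F ->
  F --> p <->
  (forall K W, compact K -> nbhs 1 W -> \forall q \near F,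
     forall x, K x -> W ((cocycle p x)^-1 * cocycle q x)) /\
  twist @ F --> twist p.
Proof.
move=> FF.
rewrite -(compact_open_uniformP cocycle (@cocycle_continuous p)).
transitivity (val @ F --> val p); first exact: initial_cvgP.
transitivity ((fun q => (val q).1) @ F --> (val p).1 /\ twist @ F --> twist p).
  split=> [Fp|[Fp1 Fp2]].
    by split; apply: cvg_comp Fp _; [exact: cvg_fst|exact: cvg_snd].
  have valE (q : Der M) : val q = ((val q).1, (val q).2) by case: (val q).
  by rewrite valE (funext valE); exact: (cvg_pair Fp1 Fp2).
suff -> : (fun q => (val q).1) @ F --> (val p).1 <->
  (forall K O, compact K -> open O -> cocycle p @` K `<=` O ->
     \forall q \near F, cocycle q @` K `<=` O) by [].
transitivity ((fun q : Der M => cocycle q : {compact-open, G -> A}) @ F -->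
   (cocycle p : {compact-open, G -> A})).
  exact: initial_cvgP.
exact: compact_open_cvgP.
Qed.

Lemma twist_continuous : continuous twist.
Proof. by move=> p; have /Der_cvgP[] : nbhs p --> p by []. Qed.

Lemma cocycle_at_continuous x : continuous (fun q => cocycle q x).
Proof.
move=> p N /nbhs_mulg N1.
have /Der_cvgP[/(_ [set x] _ (@compact_set1 _ x) N1) + _] : nbhs p --> p by [].
by apply: filterS => q /(_ x erefl) /=; rewrite mulVKg.
Qed.

(** The sets on the right form a filter, which converges to [p] by
    [Der_cvgP]. *)
Lemma nbhs_DerP (p : Der M) (N : set (Der M)) : nbhs p N <->
  exists K W L, [/\ compact K, nbhs 1 W, nbhs (twist p) L &
    forall q, (forall x, K x -> W ((cocycle p x)^-1 * cocycle q x)) ->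
      L (twist q) -> N q].
Proof.
split; last first.
  move=> [K [W [L [cK W1 Lp KWLN]]]].
  have /Der_cvgP[/(_ K W cK W1) pW _] : nbhs p --> p by [].
  have pL : \forall q \near p, L (twist q) by exact: twist_continuous.
  by apply: filterS2 pW pL => q; exact: KWLN.
pose F : set_system (Der M) := [set N | exists K W L,
   [/\ compact K, nbhs 1 W, nbhs (twist p) L &
    forall q, (forall x, K x -> W ((cocycle p x)^-1 * cocycle q x)) ->
      L (twist q) -> N q]].
have FF : Filter F.
  split.
  - exists set0, setT, setT.
    by split=> //; [exact: compact0|exact: filterT|exact: filterT].
  - move=> N1 N2 [K1 [W1 [L1 [c1 w1 l1 h1]]]] [K2 [W2 [L2 [c2 w2 l2 h2]]]].
    exists (K1 `|` K2), (W1 `&` W2), (L1 `&` L2); split.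
    + exact: compactU.
    + exact: filterI.
    + exact: filterI.
    + move=> q qW [Lq1 Lq2]; split.
        by apply: h1 => // x Kx; have [] := qW x (or_introl Kx).
      by apply: h2 => // x Kx; have [] := qW x (or_intror Kx).
  - move=> N1 N2 N12 [K [W [L [c w l h]]]]; exists K, W, L; split=> // q qW qL.
    by apply: N12; exact: h.
suff : F --> p by exact.
apply/Der_cvgP; split=> [K W cK W1|L Lp].
  by exists K, W, setT; split=> //; exact: filterT.
by exists set0, setT, L; split=> //; [exact: compact0|exact: filterT].
Qed.

Lemma closed_pointwise_ball (p : Der M) x (W : set A) : closed W ->
  closed [set q : Der M | W ((cocycle p x)^-1 * cocycle q x)].
Proof.
move=> clW.
apply: (@preimage_closed _ _ (fun q => (cocycle p x)^-1 * cocycle q x)) => // q _.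
by apply: (cvgMg (cvg_cst _) (@cocycle_at_continuous x q)).
Qed.

(** [Der M] is regular because [A] and [R] are: shrink the neighbourhoods [W]
    and [L] of [nbhs_DerP] to closed ones. *)
Lemma nbhs_Der_closed (p : Der M) (N : set (Der M)) : nbhs p N ->
  exists2 Z, closed Z & nbhs p Z /\ Z `<=` N.
Proof.
move=> /nbhs_DerP[K [W [L [cK W1 Lp KWLN]]]].
have [W' clW' [W'1 W'W]] := nbhs1_closed W1.
have [L' clL' [L'p L'L]] := nbhs_closed Lp.
exists ((\bigcap_(x in K) [set q | W' ((cocycle p x)^-1 * cocycle q x)]) `&`
  (twist @^-1` L')); last split.
- apply: closedI; last first.
    by apply: preimage_closed => // q _; exact: twist_continuous.
  by apply: closed_bigI => x Kx; exact: closed_pointwise_ball.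
- by apply/nbhs_DerP; exists K, W', L'.
- by move=> q [qW' /L'L]; apply: KWLN => x /qW' /W'W.
Qed.

End Cocycles.

Arguments twist {G R A M} p.

(** * Equicontinuity and compactness *)

(** If [f] maps [V] into [U_1], then [x, ..., x ^+ n] in [V] gives
    [f x, ..., f x ^+ n] in [U_1], that is [f x] in [U_n]. The resulting
    neighbourhood does not depend on [f]. *)
Lemma radical_based_equicontinuous (A : topologicalGroupType) :
  radical_based A -> exists E : set A, [/\ closed E, nbhs 1 E &
    forall (G : topologicalGroupType) (V : set G) (N : set A),
      nbhs 1 V -> nbhs 1 N -> exists2 W, nbhs 1 W &
      forall f : G -> A,
        {morph f : x y / x * y} -> (forall x, V x -> E (f x)) ->
        forall x, W x -> N (f x)].
Proof.
move=> [U [U1 Ubase _ _ Urad]].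
have [E clE [E1 EU]] := nbhs1_closed (U1 1%N isT).
exists E; split=> // G V N V1 /Ubase[n n0 UN].
exists [set x | forall k, (k <= n)%N -> V (x ^+ k)].
  have pow k : \forall x \near (1 : G), V (x ^+ k).
    have : (fun x : G => x ^+ k) @ (1 : G) --> (1 : G) ^+ k.
      elim: k => [|k IHk]; first exact: cvg_cst.
      rewrite expgS (_ : (fun x => _) = (fun x => x * x ^+ k)); last first.
        by apply/funext => x; rewrite expgS.
      exact: cvgMg cvg_id IHk.
    by rewrite expg1n; apply.
  elim: n {n0 UN} => [|n IHn].
    by apply: filterS (pow 0%N) => x Vx k; rewrite leqn0 => /eqP ->.
  apply: filterS2 IHn (pow n.+1) => x Vx Vxn k; rewrite leq_eqVlt ltnS.
  by move=> /predU1P[->//|]; exact: Vx.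
move=> f fM fE x Vx; apply: UN; apply: Urad => // k /andP[k0 kn].
have f1 : f 1 = 1 by apply: (@mulgI _ (f 1)); rewrite -fM !mulg1.
have fX m : f (x ^+ m) = f x ^+ m.
  by elim: m => [//|m IHm]; rewrite !expgS fM IHm.
by rewrite -fX; apply: EU; apply: fE; exact: Vx.
Qed.

Lemma ultra_compact_cvg (S : Type) (T : topologicalType) (F : set_system S)
    (K : set T) (g : S -> T) : UltraFilter F -> compact K -> F (g @^-1` K) ->
  exists2 l, K l & g @ F --> l.
Proof.
move=> UF cK FK.
have [l [Kl clFl]] := cK (g @ F) _ FK.
exists l => // N lN.
have [//|FN] := in_ultra_setVsetC (g @^-1` N) UF.
by have [y [nNy Ny]] := clFl (~` N) N FN lN.
Qed.

Section TrivialAction.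
Context (G R A : topologicalGroupType) (M : precrossedBimodule G R A).
Hypotheses (hausR : hausdorff_space R) (hausA : hausdorff_space A).
Hypotheses (cA : compact [set: A]) (trivA : H0 (actGA M) = [set: A]).

Lemma actGA_trivial g a : actGA M g a = a.
Proof. by have : H0 (actGA M) a by rewrite trivA. Qed.

Lemma cocycleM (p : Der M) : {morph cocycle p : x y / x * y}.
Proof.
by move=> x y; have /set_mem[/(_ x y)] := valP p; rewrite actGA_trivial.
Qed.

Lemma mu_cocycle (p : Der M) g :
  mu M (cocycle p g) = twist p * (actGR M g (twist p))^-1.
Proof. by have /set_mem[_] := valP p; exact. Qed.

Lemma Der_exists (f : G -> A) (s : R) :
  continuous f -> {morph f : x y / x * y} ->
  (forall g, mu M (f g) = s * (actGR M g s)^-1) ->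
  exists p : Der M, cocycle p = f /\ twist p = s.
Proof.
move=> cf fM fs.
pose f' : continuousType G A :=
  HB.pack f (isContinuous.Build _ _ f cf).
have Df : (f', s) \in Der_set M.
  by apply/mem_set; split=> //= x y; rewrite actGA_trivial; exact: fM.
by exists (Sub (f', s) Df); split.
Qed.

(** In what follows, [E] plays the role of a small closed arc around the unit of
    the circle: by [Eequi], mapping a fixed neighbourhood into [E] is an
    equicontinuity condition. *)
Context (E : set A).
Hypotheses (clE : closed E) (E1 : nbhs 1 E).
Hypothesis Eequi : forall (V : set G) (N : set A), nbhs 1 V -> nbhs 1 N ->
  exists2 W, nbhs 1 W &
  forall f : G -> A, {morph f : x y / x * y} -> (forall x, V x -> E (f x)) ->
    forall x, W x -> N (f x).

(** Ascoli's theorem, by ultrafilters: the compactness of [A] gives a pointwise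
    limit, which is again a cocycle as [A] and [R] are Hausdorff; by
    equicontinuity the limit is continuous and the convergence is uniform on
    compact sets. *)
Lemma Der_compact (V : set G) (L : set R) : nbhs 1 V -> compact L ->
  compact [set q : Der M | (forall x, V x -> E (cocycle q x)) /\ L (twist q)].
Proof.
move=> V1 cL; rewrite compact_ultra => F UF FB.
have FV : \forall q \near F, forall x, V x -> E (cocycle q x).
  by apply: filterS FB => q [].
have [gam gamP] :
    {gam : G -> A & forall x, (fun q => cocycle q x) @ F --> gam x}.
  apply: (@choice _ _ (fun x l => (fun q => cocycle q x) @ F --> l)) => x.
  have [|l _ Fl] := @ultra_compact_cvg _ _ F setT (fun q => cocycle q x) UF cA.
    exact: filterT.
  by exists l.
have [s Ls Fs] : exists2 s, L s & twist @ F --> s.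
  by apply: ultra_compact_cvg => //; apply: filterS FB => q [].
have gamM : {morph gam : x y / x * y}.
  move=> x y; apply: (cvg_unique hausA (gamP (x * y))).
  rewrite (_ : (fun q => _) = (fun q => cocycle q x * cocycle q y)); last first.
    by apply/funext => q; exact: cocycleM.
  exact: cvgMg.
have gamV x : V x -> E (gam x).
  move=> Vx; apply: (closed_cvg E clE _ _ (gamP x)).
  by apply: filterS FV => q; exact.
have cgam : continuous gam.
  move=> x N /nbhs_mulg /(Eequi V1)[W W1 WN]; apply/nbhs_mulg.
  apply: filterS W1 => w Ww /=; rewrite gamM.
  exact: WN gamV _ Ww.
have gams g : mu M (gam g) = s * (actGR M g s)^-1.
  apply: (@cvg_unique _ hausR ((fun q => mu M (cocycle q g)) @ F)).
    apply: (@cvg_comp _ _ _ (fun q => cocycle q g) (mu M) _ _ _ (gamP g)).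
    exact: mu_continuous.
  rewrite (_ : (fun q => _) =
      (fun q => twist q * (actGR M g (twist q))^-1)); last first.
    by apply/funext => q; exact: mu_cocycle.
  apply: (cvgMg Fs); apply: cvgVg.
  apply: (@cvg_comp _ _ _ (fun q => (g, twist q))
    (fun z : G * R => actGR M z.1 z.2) _ (nbhs (g, s)));
    last exact: (@act_continuous _ _ _ (g, s)).
  exact: (cvg_pair (cvg_cst g) Fs).
have [p [pgam ps]] := Der_exists cgam gamM gams.
exists p; split; first by rewrite /= pgam ps.
apply/Der_cvgP; rewrite pgam ps; split=> // K W /compact_near_coveringP cK W1.
apply: cK => x _.
(* With [w = x^-1 * y], the quotient of [gam y] and [cocycle q y] is
   [(gam w)^-1 * ((gam x)^-1 * cocycle q x) * cocycle q w]. *)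
have [N1 N11 N1W] := nbhs1_split W1.
have [N2 N21 N2N1] := nbhs1_split N11.
have [W0 W01 W0N] := Eequi V1 (filterI N11 N21).
have Fx : \forall q \near F, N2 ((gam x)^-1 * cocycle q x).
  by apply: (cvgMg (cvg_cst _) (gamP x)); rewrite mulVg.
have xW0 : \forall y \near x, W0 (x^-1 * y).
  by apply/nbhs_mulg; apply: filterS W01 => w /=; rewrite mulKg.
exists ([set y | W0 (x^-1 * y)],
  [set q | N2 ((gam x)^-1 * cocycle q x) /\ forall x, V x -> E (cocycle q x)]).
  by split=> //; exact: filterI.
move=> [y q] [/= W0y [N2q qV]].
have [_ N2gam] := W0N gam gamM gamV _ W0y.
have [N1q _] := W0N _ (cocycleM q) qV _ W0y.
have [_ N1gq _] := N2N1 _ _ N2gam N2q.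
have [Wy _ _] := N1W _ _ N1gq N1q.
rewrite /= -(mulVKg x y) gamM (cocycleM q x) invgM -!mulgA.
by rewrite -!mulgA in Wy.
Qed.

(** * The Banach-Dieudonne argument *)

(** Let [q] be a point of [T] outside [O] that maps [V'] into [E]. It does not map
    [V] into [E], so by [WE] it leaves the [W]-ball around [p] at some point of
    [V]. The points that leave this ball at a given [x] form an open set, and
    the [q] in question form a compact set, so finitely many [x] suffice. *)
Lemma finite_separation (p : Der M) (V V' : set G) (W : set A) (L : set R)
    (T O : set (Der M)) :
  nbhs 1 V' -> compact L -> closed W ->
  (forall a x, W a -> V x -> E (cocycle p x * a)) ->
  closed T -> T `<=` twist @^-1` L ->
  (forall K x, compact K -> K x -> O x -> \forall y \near x, K y -> O y) ->
  (forall q, T q -> (forall x, V x -> E (cocycle q x)) -> O q) ->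
  exists2 F : seq G, {subset F <= [pred x | `[< V x >]]} & forall q, T q ->
    (forall x, x \in F -> W ((cocycle p x)^-1 * cocycle q x)) ->
    (forall x, V' x -> E (cocycle q x)) -> O q.
Proof.
move=> V'1 cL clW WE clT TL kO TO.
pose B := [set q : Der M | (forall x, V' x -> E (cocycle q x)) /\ L (twist q)].
have cB : compact B by exact: Der_compact.
have cTB : compact (B `&` T) by exact: compact_closedI.
(* The finite subsets of [V], directed by inclusion. *)
pose good := [set s : seq G | forall x, x \in s -> V x].
pose F := filter_from good (fun s => [set s' | good s' /\ {subset s <= s'}]).
have FF : Filter F.
  apply: filter_from_filter; first by exists [::].
  move=> s t gs gt; exists (s ++ t).
    by move=> x; rewrite mem_cat => /orP[/gs|/gt].
  move=> u [gu stu]; split; split=> // x xs; apply: stu.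
    by rewrite mem_cat xs.
  by rewrite mem_cat xs orbT.
have cov : \forall s \near F, B `&` T `<=` [set q | O q \/
    exists2 x, x \in s & ~ W ((cocycle p x)^-1 * cocycle q x)].
  move/compact_near_coveringP/near_covering_withinP: (cTB); apply => q [Bq Tq].
  have [Oq|nOq] := pselect (O q).
    exists ([set y | (B `&` T) y -> O y], setT) => /=.
      by split; [exact: kO|exact: filterT].
    by move=> [y s] [/= yO _] /yO; left.
  have [x [Vx nEx]] : exists x, V x /\ ~ E (cocycle q x).
    apply: contrapT => nx; apply/nOq/TO => // x Vx.
    by apply: contrapT => nEx; apply: nx; exists x.
  exists ([set y | ~ W ((cocycle p x)^-1 * cocycle y x)],
    [set s | x \in s]) => /=.
    split.
      have oW : open [set y : Der M | ~ W ((cocycle p x)^-1 * cocycle y x)].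
        exact: (closed_openC (@closed_pointwise_ball _ _ _ M p x W clW)).
      move: oW; rewrite openE; apply => /= /WE /(_ Vx).
      by rewrite mulVKg.
    exists [:: x]; first by move=> y; rewrite inE => /eqP ->.
    by move=> s [_ xs]; apply: xs; rewrite inE.
  by move=> [y s] [/= nW xs] _; right; exists x.
have [s gs sP] := cov.
have {}sP := sP s (conj gs (fun _ => id)).
exists s; first by move=> x /gs Vx; apply/asboolP.
move=> q Tq qW qE.
have [//|[x xs]] := sP q (conj (conj qE (TL _ Tq)) Tq).
by case; exact: qW.
Qed.

Hypotheses (fcG : first_countable G) (lcR : locally_compact [set: R]).

Lemma Der_k_space : k_space (Der M).
Proof.
apply: k_spaceP => O kO p Op.
have [V0 [V0n V0decr V0base]] := first_countable_base (1 : G) fcG.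
have [W0 W01 W0E] := nbhs1_split E1.
have [W clW [W1 WW0]] := nbhs1_closed W01.
have p1 : cocycle p 1 = 1.
  by apply: (@mulgI _ (cocycle p 1)); rewrite -(cocycleM p) !mulg1.
have [m V0m] : exists m, V0 m `<=` [set x | W0 (cocycle p x)].
  by apply: V0base; apply: cocycle_continuous; rewrite p1.
pose V n : set G := V0 (m + n)%N.
have Vn n : nbhs 1 (V n) by exact: V0n.
have Vdecr k n : (k <= n)%N -> V n `<=` V k.
  by move=> kn; apply: V0decr; rewrite leq_add2l.
have Vbase N : nbhs 1 N -> exists n, V n `<=` N.
  move=> /V0base[n V0N]; exists n; apply: subset_trans V0N.
  by apply: V0decr; exact: leq_addl.
have pV n x : V n x -> W0 (cocycle p x).
  by move=> Vx; apply: V0m; apply: V0decr Vx; exact: leq_addr.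
have WE n a x : W a -> V n x -> E (cocycle p x * a).
  by move=> Wa /pV W0x; have [] := W0E _ _ W0x (WW0 _ Wa).
have [L Lp cL] : exists2 L, nbhs (twist p) L & compact L.
  have [L Lp [cL _]] := @lcR (twist p) I.
  exists L => //.
  have : \forall s \near twist p, [set: R] s -> L s by exact: Lp.
  by apply: filterS => s; exact.
have [T0 clT0 [pT0 T0P]] : exists2 T, closed T & nbhs p T /\
    T `<=` [set q | L (twist q) /\
      ((forall x, V 0%N x -> E (cocycle q x)) -> O q)].
  apply: nbhs_Der_closed; apply: filterI; first exact: twist_continuous.
  have cB := Der_compact (Vn 0%N) cL.
  have Bp : (forall x, V 0%N x -> E (cocycle p x)) /\ L (twist p).
    split; last exact: nbhs_singleton.
    move=> x Vx; rewrite -[cocycle p x]mulg1; apply: (WE 0%N) => //.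
    exact: nbhs_singleton.
  have pL : \forall q \near p, L (twist q) by exact: twist_continuous.
  apply: filterS2 (kO _ _ cB Bp Op) pL => q qO Lq qE; exact: qO.
pose good n (T : set (Der M)) := [/\ closed T, T `<=` twist @^-1` L &
  forall q, T q -> (forall x, V n x -> E (cocycle q x)) -> O q].
(* As the choice of [F n] depends on [T n], it is made for all pairs at once. *)
have step (nT : nat * set (Der M)) : exists F : seq G, good nT.1 nT.2 ->
    {subset F <= [pred x | `[< V nT.1 x >]]} /\
    forall q, nT.2 q ->
      (forall x, x \in F -> W ((cocycle p x)^-1 * cocycle q x)) ->
      (forall x, V nT.1.+1 x -> E (cocycle q x)) -> O q.
  case: nT => n T /=.
  have [[clT TL TO]|ngood] := pselect (good n T); last by exists [::].
  have [F FV FO] := finite_separation (Vn n.+1) cL clW (WE n) clT TL kO TO.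
  by exists F.
have [f fP] := choice step.
pose fix T n := if n is k.+1 then T k `&`
  [set q | forall x, x \in f (k, T k) -> W ((cocycle p x)^-1 * cocycle q x)]
  else T0.
have Tgood n : good n (T n).
  elim: n => [|n IHn].
    by split=> [//|q /T0P[]//|q /T0P[_]]; exact.
  have [_ FO] := fP (n, T n) IHn.
  have [clT TL _] := IHn; split.
  - apply: closedI => //.
    apply: (@closed_bigI _ _ [set` f (n, T n)]) => x _.
    exact: closed_pointwise_ball.
  - by move=> q [/TL].
  - by move=> q [Tq qW]; exact: FO.
pose F n := f (n, T n).
have FV n x : x \in F n -> V n x.
  by move=> xF; have [/(_ x xF)/asboolP] := fP (n, T n) (Tgood n).
have cC := compact_finite_sets_tending Vdecr Vbase FV.
have pW : \forall q \near p, forall x, (x = 1 \/ exists n, x \in F n) ->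
    W ((cocycle p x)^-1 * cocycle q x).
  apply/nbhs_DerP; exists [set x | x = 1 \/ exists n, x \in F n], W, setT.
  by split=> //; exact: filterT.
apply: filterS2 pT0 pW => q T0q qW.
have Tq n : T n q.
  elim: n => [//|n IHn]; split=> // x xF; apply: qW; right; by exists n.
have q1 : cocycle q 1 = 1.
  by apply: (@mulgI _ (cocycle q 1)); rewrite -(cocycleM q) !mulg1.
have [n VnE] : exists n, V n `<=` [set x | E (cocycle q x)].
  by apply: Vbase; apply: cocycle_continuous; rewrite q1.
by have [_ _ TO] := Tgood n; apply: TO.
Qed.

End TrivialAction.

Theorem theorem3p10 (G R A : topologicalGroupType)
  (M : precrossedBimodule G R A)
  (hausG : hausdorff_space G) (hausR : hausdorff_space R)
  (hausA : hausdorff_space A)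
  (pcM : partially_crossed M)
  (fcG : first_countable G)
  (lcR : locally_compact [set: R])
  (cA : compact [set: A]) (rbA : radical_based A)
  (hA : H0 (actGA M) = [set: A]) :
  k_space (H1 M).
Proof.
have [E [clE E1 Eequi]] := radical_based_equicontinuous rbA.
apply: k_space_quotient.
exact: Der_k_space (Eequi G) fcG lcR.
Qed.
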